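(* Let $T:\mathbb{R}^n\to\mathbb{R}^n$ be a bounded (possibly nonlinear) operator, let $f\in\mathbb{R}^n$, $f\neq 0$, and let $\{u^k\}_{k\ge 0}$ be the power iteration of $T$ started at $f$, assumed to be well defined. Then the iteration converges after a finite number of steps, i.e. there exists $N$ such that $u^{k+1}=u^k$ for all $k>N$, if and only if some iterate $u^k$ solves the eigenproblem $T(u^k)=\lambda u^k$ for some $\lambda\in\mathbb{R}$.
   Context: $\langle\cdot,\cdot\rangle$ is the Euclidean inner product on $\mathbb{R}^n$ and $\|\cdot\|$ is the $\ell^2$-norm. The power iteration of $T$ started at $f$ is the infinite sequence defined by $u^0=f/\|f\|$ and $$u^{k+1}=\operatorname{sign}(\langle u^k,T(u^k)\rangle)\,\frac{T(u^k)}{\|T(u^k)\|},\qquad k\ge 0$$ (the stopping criterion of the numerical algorithm is disregarded). It is well defined if for all $k$: $0<\|T(u^k)\|<\infty$ and $\langle u^k,T(u^k)\rangle\neq 0$; this is a standing assumption. An eigenfunction of $T$ is a $u\in\mathbb{R}^n$, $u\ne 0$, with $T(u)=\lambda u$ for some $\lambda\in\mathbb{R}$. *)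

(* Defs.v *)
From mathcomp Require Import all_boot all_order all_algebra.
From mathcomp Require Import boolp classical_sets reals.

Set Implicit Arguments.
Unset Strict Implicit.
Unset Printing Implicit Defensive.

Import Order.TTheory GRing.Theory Num.Theory.

Local Open Scope classical_set_scope.
Local Open Scope ring_scope.

Definition dot (R : realType) (n : nat) (u v : 'cV[R]_n) : R :=
  \sum_(i < n) u i 0 * v i 0.

(* The canonical norm on matrices is the sup norm, hence
   this separate definition of the l^2 norm. *)
Definition l2norm (R : realType) (n : nat) (u : 'cV[R]_n) : R :=
  Num.sqrt (dot u u).

Definition l2bounded (R : realType) (n : nat) (A : set 'cV[R]_n) : Prop :=
  exists M : R, forall u, A u -> l2norm u <= M.

(* Boundedness of a nonlinear operator: bounded sets have bounded images.  Both
   a linear growth bound |T u| <= C |u| and a bounded range imply it. *)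
Definition bounded_operator (R : realType) (n : nat)
    (T : 'cV[R]_n -> 'cV[R]_n) : Prop :=
  forall A : set 'cV[R]_n, l2bounded A -> l2bounded (T @` A).

(* Division is total, with x / 0 = 0, so every iterate has a value; the values
   are the intended ones when f != 0 and [power_iteration_well_defined]. *)
Fixpoint power_iteration (R : realType) (n : nat)
    (T : 'cV[R]_n -> 'cV[R]_n) (f : 'cV[R]_n) (k : nat) : 'cV[R]_n :=
  if k is k'.+1 then
    let u := power_iteration T f k' in
    Num.sg (dot u (T u)) *: ((l2norm (T u))^-1 *: T u)
  else (l2norm f)^-1 *: f.

(* |T u^k| < oo needs no clause, the norm being real-valued. *)
Definition power_iteration_well_defined (R : realType) (n : nat)
    (T : 'cV[R]_n -> 'cV[R]_n) (f : 'cV[R]_n) : Prop :=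
  forall k : nat, let u := power_iteration T f k in
    0 < l2norm (T u) /\ dot u (T u) <> 0.

(* Main.v *)
(* On unit vectors the normalised, sign-corrected step [u |-> sg <u, T u> T u / |T u|]
   fixes exactly the eigenvectors of [T]: if [T u = l u] with [|u| = 1], then
   [<u, T u> = l] and [|T u| = |l|], so the step returns [sg l * l / |l| * u = u].
   Once the iteration reaches a fixed point, it stays there. *)
Require Import Defs.
From mathcomp Require Import all_boot all_order all_algebra.
From mathcomp Require Import boolp classical_sets reals.

Import Order.TTheory GRing.Theory Num.Theory.

Local Open Scope ring_scope.

Lemma dotZl (R : realType) (n : nat) (a : R) (u v : 'cV[R]_n) :
  dot (a *: u) v = a * dot u v.
Proof.
by rewrite /dot mulr_sumr; apply: eq_bigr => i _; rewrite mxE mulrA.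
Qed.

Lemma dotZr (R : realType) (n : nat) (a : R) (u v : 'cV[R]_n) :
  dot u (a *: v) = a * dot u v.
Proof.
by rewrite /dot mulr_sumr; apply: eq_bigr => i _; rewrite mxE mulrCA.
Qed.

Lemma dot_gt0 (R : realType) (n : nat) (u : 'cV[R]_n) : u != 0 -> 0 < dot u u.
Proof.
have sq_ge0 (i : 'I_n) : true -> 0 <= u i 0 * u i 0.
  by rewrite -expr2 sqr_ge0.
move=> u0; rewrite lt_def sumr_ge0 // andbT.
apply: contra u0 => /eqP /(psumr_eq0P sq_ge0) uu0.
apply/eqP/colP => i; rewrite mxE; apply/eqP.
(* Duplicating the test as [b || b] turns it into the vanishing of the square [u i 0 * u i 0]. *)
by rewrite -[_ == 0]orbb -mulf_eq0 uu0.
Qed.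

Lemma l2norm_gt0 (R : realType) (n : nat) (u : 'cV[R]_n) :
  u != 0 -> 0 < l2norm u.
Proof. by move=> u0; rewrite sqrtr_gt0 dot_gt0. Qed.

Lemma l2normZ (R : realType) (n : nat) (a : R) (u : 'cV[R]_n) :
  l2norm (a *: u) = `|a| * l2norm u.
Proof.
by rewrite /l2norm dotZl dotZr mulrA -expr2 sqrtrM ?sqr_ge0 // sqrtr_sqr.
Qed.

Lemma l2norm_normalize (R : realType) (n : nat) (u : 'cV[R]_n) :
  0 < l2norm u -> l2norm ((l2norm u)^-1 *: u) = 1.
Proof.
by move=> u0; rewrite l2normZ gtr0_norm ?invr_gt0 // mulVf ?gt_eqF.
Qed.

(** Each step multiplies a normalised vector by a sign, which is [1] or [-1] and never [0] because
    [dot u (T u)] is nonzero. *)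
Lemma l2norm_power_iteration (R : realType) (n : nat)
    (T : 'cV[R]_n -> 'cV[R]_n) (f : 'cV[R]_n) (k : nat) :
  f <> 0 -> power_iteration_well_defined T f ->
  l2norm (power_iteration T f k) = 1.
Proof.
move=> /eqP f0 wd; case: k => [|k]; first exact/l2norm_normalize/l2norm_gt0.
have [Tu0 /eqP uTu0] := wd k.
by rewrite /= l2normZ l2norm_normalize // mulr1 normr_sg uTu0.
Qed.

Lemma power_iteration_eigen (R : realType) (n : nat)
    (T : 'cV[R]_n -> 'cV[R]_n) (f : 'cV[R]_n) (k : nat) (lambda : R) :
  f <> 0 -> power_iteration_well_defined T f ->
  T (power_iteration T f k) = lambda *: power_iteration T f k ->
  power_iteration T f k.+1 = power_iteration T f k.
Proof.
move=> f0 wd Tu; have [_ +] := wd k; rewrite /= Tu.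
have := l2norm_power_iteration _ _ T f k f0 wd.
set u := power_iteration T f k => u1.
have uu0 : 0 < dot u u by rewrite -sqrtr_gt0 -/(l2norm u) u1.
(* Here [dot u (T u)] is [lambda * dot u u], so its being nonzero excludes the eigenvalue [0]. *)
rewrite dotZr => /eqP; rewrite mulf_eq0 (gt_eqF uu0) orbF => l0.
rewrite sgrM (gtr0_sg uu0) mulr1 l2normZ u1 mulr1 !scalerA -mulrA mulrCA.
by rewrite -normrEsg mulVf ?normr_eq0 // scale1r.
Qed.

(** The next iterate is a function of the current one alone, so one repetition propagates by
    induction. *)
Lemma power_iteration_stationary (R : realType) (n : nat)
    (T : 'cV[R]_n -> 'cV[R]_n) (f : 'cV[R]_n) (j k : nat) :
  power_iteration T f j.+1 = power_iteration T f j -> (j <= k)%N ->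
  power_iteration T f k.+1 = power_iteration T f k.
Proof.
move=> step_j /subnK <-; elim: (k - j)%N => // m IH.
by rewrite addSn [LHS]/= -/(power_iteration T f (m + j).+1) IH.
Qed.

Theorem proposition1 (R : realType) (n : nat) (T : 'cV[R]_n -> 'cV[R]_n)
    (f : 'cV[R]_n) (hT : bounded_operator T) (hf : f <> 0)
    (hwd : power_iteration_well_defined T f) :
  (exists N : nat, forall k : nat, (N < k)%N ->
     power_iteration T f k.+1 = power_iteration T f k) <->
  (exists (k : nat) (lambda : R),
     T (power_iteration T f k) = lambda *: power_iteration T f k).
Proof.
split=> [[N stat]|[k [lambda Tu]]]; last first.
  exists k => m /ltnW; apply: power_iteration_stationary.
  exact: power_iteration_eigen hf hwd Tu.
(* The bound [N < k] is strict: [N.+1] is the first index known to be stationary. *)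
have [Tu0 /eqP uTu0] := hwd N.+1.
have := stat N.+1 (leqnn _); rewrite [power_iteration T f N.+2]/=.
rewrite -/(power_iteration T f N.+1).
set u := power_iteration T f N.+1 in Tu0 uTu0 * => step_u.
(* The eigenvalue comes from solving [step_u] for [T u], the sign being its own inverse. *)
exists N.+1, (l2norm (T u) * Num.sg (dot u (T u))).
rewrite -/u -[X in _ *: X]step_u !scalerA -!mulrA (mulrA (Num.sg _)) -expr2 sqr_sg uTu0.
by rewrite mul1r mulfV ?gt_eqF // scale1r.
Qed.
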